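(* Let $\Gamma$ be a discrete group, let $\Lambda<\Gamma$ be a locally finite commensurated subgroup, and let $G=\Gamma/\!/\Lambda$ be the Schlichting completion of $\Gamma$ relative to $\Lambda$, with canonical homomorphism $\alpha\colon\Gamma\to G$. Then the restriction map $H^\ast_c(G,\mathbb{R})\to H^\ast(\Gamma,\mathbb{R})$ (induced by $\alpha$) is an isomorphism in all degrees.
   Context: A subgroup $\Lambda<\Gamma$ is commensurated if $\Lambda\cap\gamma\Lambda\gamma^{-1}$ has finite index in both $\Lambda$ and $\gamma\Lambda\gamma^{-1}$ for every $\gamma\in\Gamma$. A group is locally finite if each of its finitely generated subgroups is finite. Left multiplication of $\Gamma$ on $\Gamma/\Lambda$ defines a homomorphism $\alpha\colon\Gamma\to\mathrm{Sym}(\Gamma/\Lambda)$. Equip $\mathrm{Sym}(\Gamma/\Lambda)$ with the topology of pointwise convergence; the Schlichting completion is the closure $\Gamma/\!/\Lambda=\overline{\alpha(\Gamma)}$. It is a totally disconnected locally compact Hausdorff group. The continuous cohomology $H^\ast_c(G,\mathbb{R})$ of a locally compact group $G$ (trivial coefficients) is the cohomology of the complex $C(G^{\ast+1},\mathbb{R})^G$ of $G$-invariant continuous functions $G^{n+1}\to\mathbb{R}$ (diagonal left action) with the standard homogeneous differential. For the discrete group $\Gamma$ the same complex computes the ordinary group cohomology $H^\ast(\Gamma,\mathbb{R})$. The restriction map is induced by the cochain map $f\mapsto f\circ\alpha^{n+1}$. *)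

(* Defs.v *)
From HB Require Import structures.
From mathcomp Require Import all_boot all_order all_algebra.
From mathcomp Require Import zify.
From mathcomp Require Import all_classical all_reals topology normedtype.

Set Implicit Arguments.
Unset Strict Implicit.
Unset Printing Implicit Defensive.

Import GRing.Theory Num.Theory.
Import numFieldNormedType.Exports.
Local Open Scope classical_set_scope.
Local Open Scope ring_scope.

Section Subgroups.
Variable Gam : groupType.

Definition gen_subgroup (S : set Gam) : set Gam :=
  [set x | forall K : groupClosed Gam, S `<=` [set` K] -> x \in K].

Definition finitely_generated (H : set Gam) : Prop :=
  exists2 S : set Gam, finite_set S & H = gen_subgroup S.

Definition locally_finite (Lam : groupClosed Gam) : Prop :=
  forall H : groupClosed Gam, [set` H] `<=` [set` Lam] ->
    finitely_generated [set` H] -> finite_set [set` H].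

(* Meaningful for subgroups H `<=` K: the set of cosets xH, x in K, is finite *)
Definition finite_index (H K : set Gam) : Prop :=
  finite_set [set [set (x * h)%g | h in H] | x in K].

Definition conj_set (g : Gam) (A : set Gam) : set Gam :=
  [set (g * x * g^-1)%g | x in A].

Definition commensurated (Lam : groupClosed Gam) : Prop :=
  forall g : Gam, let L := [set` Lam] in
    finite_index (L `&` conj_set g L) L /\
    finite_index (L `&` conj_set g L) (conj_set g L).

End Subgroups.

HB.mixin Record isTopologicalGroup G of Group G & Topological G := {
  mulg_continuous : continuous (fun xy : G * G => (xy.1 * xy.2)%g) ;
  invg_continuous : continuous (fun x : G => x^-1%g)
}.

#[short(type="topologicalGroupType")]
HB.structure Definition TopologicalGroup :=
  {G of isTopologicalGroup G & Group G & Topological G}.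

#[short(type="contGroupHom")]
HB.structure Definition ContGroupHom (G H : topologicalGroupType) :=
  {f of isMultiplicative G H f & @isContinuous G H f}.

HB.instance Definition _ (G : groupType) := Group.copy (discrete_topology G) G.

Section DiscreteGroup.
Variable G : groupType.
Local Notation D := (discrete_topology G).

Lemma discrete_mulg_continuous : continuous (fun xy : D * D => (xy.1 * xy.2)%g).
Proof.
move=> [x y] A /(@nbhs_singleton D) Axy; exists ([set x], [set y]) => /=.
  by split; exact: (@discrete_set1 D).
by case=> a b /= [-> ->]; exact: Axy.
Qed.

Lemma discrete_invg_continuous : continuous (fun x : D => x^-1%g).
Proof.
move=> x A /(@nbhs_singleton D) Ax.
rewrite nbhs_filterE nbhs_principalE; apply/principal_filterP; exact: Ax.
Qed.

HB.instance Definition _ := isTopologicalGroup.Build D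
  discrete_mulg_continuous discrete_invg_continuous.

End DiscreteGroup.

Section Sym.
Variable X : choiceType.

Record Sym := MkSym { sym_fun :> X -> X; _ : `[< bijective sym_fun >] }.

HB.instance Definition _ := [isSub for sym_fun].
HB.instance Definition _ := [Choice of Sym by <:].

Lemma symP (s t : Sym) : s =1 t -> s = t.
Proof. by move=> st; apply/val_inj/funext. Qed.

Lemma sym_bij (s : Sym) : bijective s.
Proof. by case: s => f /= /asboolP. Qed.

Lemma sym_inv_subproof (s : Sym) : {g : X -> X | cancel s g /\ cancel g s}.
Proof. by apply: cid; case: (sym_bij s) => g sg gs; exists g. Qed.

Definition sym_invfun (s : Sym) : X -> X := sval (sym_inv_subproof s).

Lemma sym_invfunK (s : Sym) : cancel s (sym_invfun s).
Proof. by rewrite /sym_invfun; case: sym_inv_subproof => g []. Qed.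

Lemma sym_invfunVK (s : Sym) : cancel (sym_invfun s) s.
Proof. by rewrite /sym_invfun; case: sym_inv_subproof => g []. Qed.

Definition sym_one : Sym := MkSym (asboolT (Bijective (frefl id) (frefl id))).
Definition sym_mul (s t : Sym) : Sym :=
  MkSym (asboolT (bij_comp (sym_bij s) (sym_bij t))).
Definition sym_inv (s : Sym) : Sym :=
  MkSym (asboolT (Bijective (sym_invfunVK s) (sym_invfunK s))).

Lemma sym_mulA : associative sym_mul. Proof. by move=> *; exact: symP. Qed.
Lemma sym_mul1 : left_id sym_one sym_mul. Proof. by move=> *; exact: symP. Qed.
Lemma sym_1mul : right_id sym_one sym_mul. Proof. by move=> *; exact: symP. Qed.
Lemma sym_mulV : left_inverse sym_one sym_inv sym_mul.
Proof. by move=> s; apply: symP => x /=; exact: sym_invfunK. Qed.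
Lemma sym_Vmul : right_inverse sym_one sym_inv sym_mul.
Proof. by move=> s; apply: symP => x /=; exact: sym_invfunVK. Qed.

HB.instance Definition _ :=
  isGroup.Build Sym sym_mulA sym_mul1 sym_1mul sym_mulV sym_Vmul.

Lemma symM (s t : Sym) x : (s * t)%g x = s (t x). Proof. by []. Qed.

Definition sym_ptws : Sym -> {ptws X -> discrete_topology X} := sym_fun.

HB.instance Definition _ := Topological.copy Sym (initial_topology sym_ptws).
Lemma nbhs_sym (s : Sym) x : \forall t \near s, (t : Sym) x = s x.
Proof.
have c : sym_ptws @ s --> sym_ptws s.
  exact: (@initial_continuous Sym _ sym_ptws).
have px := @proj_continuous X (fun _ => discrete_topology X) x (sym_ptws s).
apply: (c _ (px [set s x] _)).
exact: (@discrete_set1 (discrete_topology X)).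
Qed.

Lemma cvg_sym (F : set_system Sym) (s : Sym) : Filter F ->
  (forall x, \forall t \near F, (t : Sym) x = s x) -> F --> s.
Proof.
move=> FF Fs.
have cF : sym_ptws @ F --> sym_ptws s.
  apply/cvg_sup => x A [_ [[B oB <-] /= Bs sBA]].
  by apply: filterS (Fs x) => t tx; apply: sBA; rewrite /= [sym_ptws t x]tx.
move=> A [_ [[B oB <-] Bs sBA]].
by apply: (filterS sBA); apply: cF; exact: open_nbhs_nbhs.
Qed.

Lemma sym_mulg_continuous : continuous (fun st : Sym * Sym => (st.1 * st.2)%g).
Proof.
move=> [s t]; apply: cvg_sym => x.
exists ([set s' : Sym | s' (t x) = s (t x)], [set t' : Sym | t' x = t x]) => /=.
  by split; exact: nbhs_sym.
by move=> [s' t'] /= [<- <-].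
Qed.

Lemma sym_invg_continuous : continuous (fun s : Sym => s^-1%g).
Proof.
move=> s; have FF : Filter ((fun s : Sym => s^-1%g) @ s).
  by apply: fmap_filter; exact: nbhs_filter.
apply: cvg_sym => x.
apply: filterS (nbhs_sym s (sym_invfun s x)) => t /=.
by rewrite sym_invfunVK => tx; rewrite -[in LHS]tx; exact: sym_invfunK.
Qed.

HB.instance Definition _ := isTopologicalGroup.Build Sym
  sym_mulg_continuous sym_invg_continuous.

End Sym.

Section ImageClosure.
Variables (Gam : groupType) (S : topologicalGroupType).
Variable f : {multiplicative Gam -> S}.

Definition image_closure : Type := set_type (closure (range f)).

HB.instance Definition _ := SubChoice.on image_closure.
HB.instance Definition _ := Topological.copy image_closure
  (set_type (closure (range f))).

Lemma gmorph1 : f 1%g = 1%g.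
Proof. by apply: (mulgI (f 1%g)); rewrite -gmulfM !mulg1. Qed.

Lemma gmorphV x : f x^-1%g = (f x)^-1%g.
Proof. by apply: (mulgI (f x)); rewrite -gmulfM !mulgV gmorph1. Qed.

Lemma image_closure_closed : group_closed (mem (closure (range f))).
Proof.
split.
  by apply/mem_set; apply: subset_closure; exists 1%g => //; exact: gmorph1.
move=> x y /set_mem clx /set_mem cly; apply/mem_set => A Axy.
have /= [[U V] /= [Ux Vy] UVA] := @mulg_continuous S (x, y^-1%g) A Axy.
have /= Vy' := @invg_continuous S y V Vy.
have [_ [[a _ <-] Ua]] := clx _ Ux.
have [_ [[b _ <-] Vb]] := cly _ Vy'.
exists (f (a * b^-1)%g); split; first by exists (a * b^-1)%g.
by rewrite gmulfM gmorphV; exact: (UVA (f a, (f b)^-1%g)).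
Qed.

HB.instance Definition _ :=
  SubChoice_isSubGroup.Build S (mem (closure (range f))) image_closure
    image_closure_closed.

Lemma image_closure_val_continuous : continuous (val : image_closure -> S).
Proof. exact: (@initial_continuous (set_type (closure (range f))) S set_val). Qed.

Lemma cvg_image_closure (F : set_system image_closure) (x : image_closure) :
  Filter F -> val @ F --> val x -> F --> x.
Proof.
move=> FF cF A [_ [[B oB <-] Bs sBA]].
by apply: (filterS sBA); apply: cF; exact: open_nbhs_nbhs.
Qed.

Lemma image_closure_mulg_continuous :
  continuous (fun xy : image_closure * image_closure => (xy.1 * xy.2)%g).
Proof.
move=> [x y]; apply: cvg_image_closure => A /=.
move=> /(@mulg_continuous S (val x, val y)) [[U V] /= [Ux Vy] UVA].
exists (val @^-1` U, val @^-1` V) => /=.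
  by split; exact: image_closure_val_continuous.
by move=> [a b] /= [Ua Vb]; exact: (UVA (val a, val b)).
Qed.

Lemma image_closure_invg_continuous :
  continuous (fun x : image_closure => x^-1%g).
Proof.
move=> x; have FF : Filter ((fun x : image_closure => x^-1%g) @ x).
  by apply: fmap_filter; exact: nbhs_filter.
apply: cvg_image_closure => A /=.
by move=> /(@invg_continuous S (val x)) /image_closure_val_continuous.
Qed.

HB.instance Definition _ := isTopologicalGroup.Build image_closure
  image_closure_mulg_continuous image_closure_invg_continuous.

Lemma corestr_subproof (x : Gam) : f x \in closure (range f).
Proof. by apply/mem_set; apply: subset_closure; exists x. Qed.

Definition corestr (x : discrete_topology Gam) : image_closure :=
  exist _ (f x) (corestr_subproof x).

Lemma corestr_morph : {morph corestr : x y / (x * y)%g}.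
Proof. by move=> x y; apply: val_inj; rewrite /= gmulfM. Qed.

Lemma corestr_continuous : continuous corestr.
Proof.
move=> x A /nbhs_singleton Ax.
by rewrite nbhs_filterE nbhs_principalE; apply/principal_filterP; exact: Ax.
Qed.

HB.instance Definition _ := isMultiplicative.Build _ _ corestr corestr_morph.
HB.instance Definition _ := isContinuous.Build _ _ corestr corestr_continuous.

End ImageClosure.

Section Schlichting.
Local Open Scope quotient_scope.
Variables (Gam : groupType) (Lam : groupClosed Gam).

(* x Lam = y Lam *)
Definition lcoset_rel (x y : Gam) : bool := (x^-1 * y)%g \in Lam.

Lemma lcoset_rel_equiv : equiv_class_of lcoset_rel.
Proof.
split=> [x|x y|y x z]; rewrite /lcoset_rel.
- by rewrite mulVg gpred1.
- by rewrite -(gpredV Lam (x^-1 * y)%g) invgM invgK.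
- by move=> xy yz; rewrite -[z](mulVKg y) mulgA gpredM.
Qed.

Canonical lcoset_equiv := EquivRelPack lcoset_rel_equiv.
Canonical lcoset_encModRel := defaultEncModRel lcoset_rel.

Definition coset_space := {eq_quot lcoset_rel}.
HB.instance Definition _ := Choice.on coset_space.
HB.instance Definition _ : EqQuotient Gam lcoset_rel coset_space :=
  EqQuotient.on coset_space.

Definition lmul_coset (g : Gam) (c : coset_space) : coset_space :=
  \pi_coset_space (g * repr c)%g.

Lemma lmul_coset_pi g x :
  lmul_coset g (\pi_coset_space x) = \pi_coset_space (g * x)%g.
Proof.
apply/eqP; rewrite eqmodE /= /lcoset_rel invgM -mulgA mulKg.
by have /eqP := reprK (\pi_coset_space x); rewrite eqmodE.
Qed.

Lemma lmul_cosetM g h c : lmul_coset (g * h)%g c = lmul_coset g (lmul_coset h c).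
Proof.
by rewrite -[c]reprK [lmul_coset h _]lmul_coset_pi !lmul_coset_pi mulgA.
Qed.

Lemma lmul_coset1 c : lmul_coset 1%g c = c.
Proof. by rewrite -[c]reprK lmul_coset_pi mul1g. Qed.

Lemma lmul_coset_bij g : bijective (lmul_coset g).
Proof.
by exists (lmul_coset g^-1%g) => c; rewrite -lmul_cosetM (mulgV, mulVg) lmul_coset1.
Qed.

Definition coset_action (g : Gam) : Sym coset_space :=
  MkSym (asboolT (lmul_coset_bij g)).

Lemma coset_action_morph : {morph coset_action : g h / (g * h)%g}.
Proof. by move=> g h; apply: symP => c /=; exact: lmul_cosetM. Qed.

HB.instance Definition _ :=
  isMultiplicative.Build _ _ coset_action coset_action_morph.

Definition schlichting : topologicalGroupType := image_closure coset_action.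

Definition schlichting_hom : contGroupHom (discrete_topology Gam) schlichting :=
  corestr coset_action.

End Schlichting.

Section QuotientModule.
Local Open Scope quotient_scope.
Variables (K : pzRingType) (V : lmodType K) (S : submodClosed V).

(* submodClosed does not inherit from zmodClosed: restore closure under -%R *)
Definition submod_zmod : {pred V} := S.

Lemma submod_zmod_closed : zmod_closed submod_zmod.
Proof. exact: GRing.submod_closedB (submodClosedP S). Qed.

HB.instance Definition _ := GRing.isZmodClosed.Build V submod_zmod
  submod_zmod_closed.

Definition quotmod := Quotient.quot submod_zmod.
HB.instance Definition _ := GRing.Zmodule.on quotmod.
HB.instance Definition _ : EqQuotient V (Quotient.equiv submod_zmod) quotmod :=
  EqQuotient.on quotmod.

Lemma pi_quotmodP (x y : V) :
  reflect (\pi_quotmod x = \pi_quotmod y) (x - y \in S).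
Proof. rewrite -[_ \in S]/(x - y \in submod_zmod) Quotient.idealrBE; exact: eqP. Qed.

Lemma pi_quotmodD x y : \pi_quotmod (x + y) = \pi_quotmod x + \pi_quotmod y.
Proof. exact: Quotient.pi_add. Qed.

Lemma repr_pi_quotmod x : repr (\pi_quotmod x) - x \in S.
Proof. by apply/pi_quotmodP; rewrite reprK. Qed.

Definition quotmod_scale (a : K) (c : quotmod) : quotmod :=
  \pi_quotmod (a *: repr c).

Lemma pi_quotmodZ a x : \pi_quotmod (a *: x) = quotmod_scale a (\pi_quotmod x).
Proof.
apply/esym/pi_quotmodP; rewrite -scalerBr rpredZ //; exact: repr_pi_quotmod.
Qed.

Lemma quotmod_scaleA a b c :
  quotmod_scale a (quotmod_scale b c) = quotmod_scale (a * b) c.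
Proof.
by rewrite -[c]reprK -[quotmod_scale b _]pi_quotmodZ -!pi_quotmodZ scalerA.
Qed.
Lemma quotmod_scale1 : left_id 1 quotmod_scale.
Proof. by move=> c; rewrite -[c]reprK -!pi_quotmodZ scale1r. Qed.
Lemma quotmod_scaleDr : right_distributive quotmod_scale +%R.
Proof.
move=> a b c; rewrite -[b]reprK -[c]reprK -pi_quotmodD -!pi_quotmodZ.
by rewrite -pi_quotmodD scalerDr.
Qed.
Lemma quotmod_scaleDl c : {morph quotmod_scale^~ c : a b / a + b}.
Proof.
by move=> a b; rewrite -[c]reprK -!pi_quotmodZ -pi_quotmodD scalerDl.
Qed.

HB.instance Definition _ := GRing.Zmodule_isLmodule.Build K quotmod
  quotmod_scaleA quotmod_scale1 quotmod_scaleDr quotmod_scaleDl.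

End QuotientModule.

Record cochainComplex (K : pzRingType) := CochainComplex {
  cochains :> nat -> lmodType K ;
  diff : forall n, {linear cochains n -> cochains n.+1} ;
  diffK : forall n (x : cochains n), diff n.+1 (diff n x) = 0
}.
Arguments diff {K} c n.

Record cochainMap (K : pzRingType) (C D : cochainComplex K) := CochainMap {
  cochain_map :> forall n, {linear C n -> D n} ;
  cochain_mapd : forall n (x : C n),
    cochain_map n.+1 (diff C n x) = diff D n (cochain_map n x)
}.

Section Cohomology.
Variables (K : pzRingType) (C : cochainComplex K).

Definition cocycle_pred n : {pred C n} := fun x => diff C n x == 0.

Lemma cocycle_submod n : submod_closed (@cocycle_pred n).
Proof.
split=> [|a x y]; rewrite !unfold_in ?linear0 //.
by move=> /eqP dx /eqP dy; rewrite linearP dx dy scaler0 addr0.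
Qed.

HB.instance Definition _ n :=
  GRing.isSubmodClosed.Build K (C n) (@cocycle_pred n) (@cocycle_submod n).

Record cocycle n := Cocycle { cocycle_val :> C n; _ : cocycle_val \in @cocycle_pred n }.

HB.instance Definition _ n := [isSub for @cocycle_val n].
HB.instance Definition _ n := [Choice of cocycle n by <:].
HB.instance Definition _ n := [SubChoice_isSubLmodule of cocycle n by <:].

Definition coboundary n : {pred cocycle n} :=
  match n return {pred cocycle n} with
  | 0 => fun z => z == 0
  | m.+1 => fun z => `[< exists y : C m, val z = diff C m y >]
  end.

Lemma coboundary_submod n : submod_closed (@coboundary n).
Proof.
split; case: n => [|n].
- by rewrite unfold_in /=.
- by rewrite unfold_in /=; apply/asboolP; exists 0; rewrite linear0.
- by move=> a x y; rewrite !unfold_in /= => /eqP-> /eqP->; rewrite scaler0 addr0.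
- move=> a x y; rewrite !unfold_in /= => /asboolP[u xu] /asboolP[v yv].
  by apply/asboolP; exists (a *: u + v); rewrite linearP /= -xu -yv.
Qed.

HB.instance Definition _ n :=
  GRing.isSubmodClosed.Build K (cocycle n) (@coboundary n) (@coboundary_submod n).

Definition cohomology n : lmodType K :=
  quotmod (@coboundary n).

End Cohomology.

Section InducedMap.
Local Open Scope quotient_scope.
Variables (K : pzRingType) (C D : cochainComplex K) (f : cochainMap C D).

Lemma cocycle_map_subproof n (z : cocycle C n) :
  f n (val z) \in @cocycle_pred K D n.
Proof.
by rewrite unfold_in -cochain_mapd; case: z => z /= /eqP ->; rewrite linear0.
Qed.

Definition cocycle_map n (z : cocycle C n) : cocycle D n :=
  Cocycle (cocycle_map_subproof z).

Lemma cocycle_map_linear n : linear (@cocycle_map n).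
Proof. by move=> a x y; apply: val_inj; rewrite /= linearP. Qed.

HB.instance Definition _ n := GRing.isLinear.Build K (cocycle C n)
  (cocycle D n) _ (@cocycle_map n) (@cocycle_map_linear n).

Lemma cocycle_map_coboundary n (z : cocycle C n) :
  z \in @coboundary K C n -> cocycle_map z \in @coboundary K D n.
Proof.
case: n z => [|n] z; rewrite !unfold_in /=.
  by move=> /eqP ->; rewrite linear0.
move=> /asboolP[y zy]; apply/asboolP; exists (f n y).
by rewrite /= zy cochain_mapd.
Qed.

Definition cohomology_map n (c : cohomology C n) : cohomology D n :=
  \pi_(quotmod (@coboundary K D n)) (cocycle_map (repr c)).

Lemma cohomology_map_pi n (z : cocycle C n) :
  cohomology_map (\pi_(quotmod (@coboundary K C n)) z) =
  \pi_(quotmod (@coboundary K D n)) (cocycle_map z).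
Proof.
apply/pi_quotmodP; rewrite -linearB; apply: cocycle_map_coboundary.
exact: repr_pi_quotmod.
Qed.

Lemma cohomology_map_linear n : linear (@cohomology_map n).
Proof.
move=> a x y; rewrite -[x]reprK -[y]reprK.
rewrite -[a *: _]pi_quotmodZ -[_ + _ in LHS]pi_quotmodD !cohomology_map_pi.
by rewrite linearP pi_quotmodD pi_quotmodZ.
Qed.

HB.instance Definition _ n := GRing.isLinear.Build K (cohomology C n)
  (cohomology D n) _ (@cohomology_map n) (@cohomology_map_linear n).

End InducedMap.

Section ContinuousCohomology.
Variables (R : realType) (G : topologicalGroupType).

Definition tuples n := {ptws 'I_n -> G}.

Definition diag_mul n (g : G) (x : tuples n) : tuples n := fun i => (g * x i)%g.

Definition omit n (i : 'I_n.+1) (x : tuples n.+1) : tuples n :=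
  fun j => x (lift i j).

Definition cochain_pred n : {pred tuples n.+1 -> R} := fun f =>
  `[< continuous f /\ forall g x, f (diag_mul g x) = f x >].

Lemma cochain_submod n : submod_closed (@cochain_pred n).
Proof.
split=> [|a f h]; rewrite !unfold_in.
  by apply/asboolP; split=> [|//]; exact: (@cst_continuous _ R 0).
move=> /asboolP[cf If] /asboolP[ch Ih]; apply/asboolP; split.
  by move=> x; exact: (cvgD (cvgM (@cvg_cst _ a _ (nbhs x) _) (cf x)) (ch x)).
by move=> g x; rewrite /= -[LHS]/(a *: f _ + h _) If Ih.
Qed.

HB.instance Definition _ n := GRing.isSubmodClosed.Build R (tuples n.+1 -> R)
  (@cochain_pred n) (@cochain_submod n).

Record cochain n := Cochain {
  cochain_fun :> tuples n.+1 -> R ; _ : cochain_fun \in @cochain_pred n }.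

HB.instance Definition _ n := [isSub for @cochain_fun n].
HB.instance Definition _ n := [Choice of cochain n by <:].
HB.instance Definition _ n := [SubChoice_isSubLmodule of cochain n by <:].

Lemma cochainP n (f : cochain n) :
  continuous (cochain_fun f) /\ forall g x, f (diag_mul g x) = f x.
Proof. by apply/asboolP; case: f. Qed.

Lemma omit_continuous n i : continuous (@omit n i).
Proof.
move=> x; have FF : Filter (@omit n i @ x).
  by apply: fmap_filter; exact: nbhs_filter.
apply/cvg_sup => j A [_ [[B oB <-] /= Bx sBA]].
apply: (filterS sBA).
apply: (@proj_continuous _ (fun=> G) (lift i j) x).
exact: open_nbhs_nbhs.
Qed.

Definition cochain_diff_fun n (f : cochain n) : tuples n.+2 -> R :=
  fun x => \sum_(i < n.+2) (-1) ^+ i * f (omit i x).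

Lemma cochain_diff_subproof n (f : cochain n) :
  cochain_diff_fun f \in @cochain_pred n.+1.
Proof.
have [cf If] := cochainP f; apply/asboolP; split=> [x|g x]; last first.
  by apply: eq_bigr => i _ /=; rewrite -(If g (omit i x)).
have FF : Filter (nbhs x) by exact: nbhs_filter.
apply: cvg_big => [|i _]; first exact: add_continuous.
apply: cvgM; first exact: cvg_cst.
by apply: (@continuous_comp _ _ _ (omit i) f); [exact: omit_continuous|exact: cf].
Qed.

Definition cochain_diff n (f : cochain n) : cochain n.+1 :=
  Cochain (cochain_diff_subproof f).

Lemma cochain_diff_linear n : linear (@cochain_diff n).
Proof.
move=> a f h; apply: val_inj; apply/funext => x /=.
rewrite -[RHS]/(a * _ + _) mulr_sumr -big_split /=; apply: eq_bigr => i _.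
by rewrite -[(a *: f + h) _]/(a * _ + _) mulrDr mulrCA.
Qed.

HB.instance Definition _ n := GRing.isLinear.Build R (cochain n)
  (cochain n.+1) _ (@cochain_diff n) (@cochain_diff_linear n).

(* The involution of the faces of codimension 2 that exchanges the two orders
   of omission. *)
Definition swap_face n (p : 'I_n.+3 * 'I_n.+2) : 'I_n.+3 * 'I_n.+2 :=
  (lift p.1 p.2, inord (unbump (bump p.1 p.2) p.1)).

Lemma swap_face2E n (p : 'I_n.+3 * 'I_n.+2) :
  (swap_face p).2 = unbump (bump p.1 p.2) p.1 :> nat.
Proof.
case: p => i j /=; rewrite inordK //.
have := ltn_ord i; have := ltn_ord j; rewrite /bump /unbump.
by case: (leqP i j) => ij; rewrite ?add0n ?add1n; case: ltnP => /=; lia.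
Qed.

Lemma swap_faceK n : involutive (@swap_face n).
Proof.
move=> p; have E := swap_face2E p; have E2 := swap_face2E (swap_face p).
apply/eqP; rewrite -pair_eqE /pair_eq -!val_eqE /= in E E2 *.
rewrite E2 E /bump /unbump; case: p {E E2} => i j /=.
by apply/andP; split; apply/eqP; lia.
Qed.

Lemma omit_swap n (p : 'I_n.+3 * 'I_n.+2) (x : tuples n.+3) :
  omit (swap_face p).2 (omit (swap_face p).1 x) = omit p.2 (omit p.1 x).
Proof.
apply/funext => k; rewrite /omit; congr (x _); apply/val_inj => /=.
by have /= -> := swap_face2E p; rewrite /bump /unbump; lia.
Qed.

Lemma sign_swap n (p : 'I_n.+3 * 'I_n.+2) :
  (-1) ^+ ((swap_face p).1 + (swap_face p).2) = - (-1) ^+ (p.1 + p.2) :> R.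
Proof.
have -> : - (-1) ^+ (p.1 + p.2) = (-1) ^+ (p.1 + p.2).+1 :> R.
  by rewrite exprS mulN1r.
rewrite -signr_odd -[RHS]signr_odd; congr ((-1) ^+ nat_of_bool _).
by have /= -> := swap_face2E p; rewrite /bump /unbump; lia.
Qed.

Lemma cochain_diffK n (f : cochain n) : cochain_diff (cochain_diff f) = 0.
Proof.
apply: val_inj; apply/funext => x /=; rewrite /cochain_diff_fun /=.
pose F (p : 'I_n.+3 * 'I_n.+2) : R :=
  (-1) ^+ (p.1 + p.2) * f (omit p.2 (omit p.1 x)).
transitivity (\sum_p F p).
  rewrite -(pair_bigA _ (fun i j => F (i, j))) /=; apply: eq_bigr => i _.
  by rewrite mulr_sumr; apply: eq_bigr => j _; rewrite mulrA -exprD.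
apply/eqP; rewrite -eqNr -sumrN; apply/eqP.
rewrite [RHS](reindex_inj (can_inj (@swap_faceK n))) /=.
by apply: eq_bigr => p _; rewrite /F omit_swap sign_swap mulNr.
Qed.

Definition cont_cochains : cochainComplex R :=
  @CochainComplex R (fun n => cochain n : lmodType R)
    (fun n => @cochain_diff n : {linear cochain n -> cochain n.+1}) cochain_diffK.

End ContinuousCohomology.

Definition cont_cohomology (R : realType) (G : topologicalGroupType) n :
    lmodType R :=
  cohomology (cont_cochains R G) n.

(* On a discrete group every homogeneous cochain is continuous, so this is the
   ordinary cohomology of Gam with trivial coefficients. *)
Definition group_cohomology (R : realType) (Gam : groupType) n : lmodType R :=
  cont_cohomology R (discrete_topology Gam) n.

Section Restriction.
Variables (R : realType) (G H : topologicalGroupType) (a : contGroupHom G H).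

Definition map_tuple n (x : tuples G n) : tuples H n := fun i => a (x i).

Lemma map_tuple_continuous n : continuous (@map_tuple n).
Proof.
move=> x; have FF : Filter (@map_tuple n @ x).
  by apply: fmap_filter; exact: nbhs_filter.
apply/cvg_sup => j A [_ [[B oB <-] /= Bx sBA]].
apply: (filterS sBA).
have ca : continuous a by exact: cts_fun.
have aB : nbhs (x j) (a @^-1` B).
  by apply: (ca (x j)); exact: open_nbhs_nbhs.
exact: (@proj_continuous _ (fun=> G) j x _ aB).
Qed.

Lemma pullback_subproof n (f : cochain R H n) :
  cochain_fun f \o @map_tuple n.+1 \in @cochain_pred R G n.
Proof.
have [cf If] := cochainP f; apply/asboolP; split=> [x|g x] /=.
  apply: (@continuous_comp _ _ _ (@map_tuple n.+1) f); last exact: cf.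
  exact: map_tuple_continuous.
rewrite -(If (a g) (map_tuple x)); congr (cochain_fun f _); apply/funext => i.
by rewrite /map_tuple /diag_mul gmulfM.
Qed.

Definition pullback n (f : cochain R H n) : cochain R G n :=
  Cochain (pullback_subproof f).

Lemma pullback_linear n : linear (@pullback n).
Proof. by move=> c f h; apply: val_inj. Qed.

HB.instance Definition _ n := GRing.isLinear.Build R (cochain R H n)
  (cochain R G n) _ (@pullback n) (@pullback_linear n).

Lemma pullback_diff n (f : cochain R H n) :
  pullback (cochain_diff f) = cochain_diff (pullback f).
Proof. by apply: val_inj. Qed.

Definition pullback_map : cochainMap (cont_cochains R H) (cont_cochains R G) :=
  @CochainMap R (cont_cochains R H) (cont_cochains R G)
    (fun n => @pullback n : {linear cochain R H n -> cochain R G n}) pullback_diff.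

Definition restriction n :
    {linear cont_cohomology R H n -> cont_cohomology R G n} :=
  @cohomology_map R _ _ pullback_map n.

End Restriction.

(* Main.v *)
Require Import Defs.
From HB Require Import structures.
From mathcomp Require Import all_boot all_order all_algebra ring.
From mathcomp Require Import all_classical all_reals topology normedtype.

(** The idea is to compute both cohomologies with the coset space X = Gam / Lam:
    a homogeneous cochain that depends only on the cosets of its arguments is at
    the same time a cochain of Gam and, since X is discrete and the closure G of
    Gam has the same orbits on finite tuples of X as Gam, a continuous cochain
    of G.  Averaging over Lam turns an arbitrary cochain into one of this kind.

    What has to be averaged is an arbitrary real function on Lam, not a bounded
    one, so an invariant mean in the usual sense is not enough.  Because Lam is
    locally finite there is nevertheless a linear form M on all functions, left
    invariant under Lam, sending constants to themselves, and bounded by e on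
    the functions bounded by e (mean_exists).  Indeed the averages over the
    finite subgroups of Lam converge along a fine enough ultrafilter for every
    bounded function; a form that vanishes on the functions with averages
    tending to 0 exists by Zorn's lemma, because the constant 1 is not such a
    function, and it is invariant because phi and its translate by m have equal
    averages on each finite subgroup that contains m.

    For a homomorphism a from Gam to a group H, smear averages a function of a
    tuple of elements of H by right translation of each entry by a(Lam), with an
    independent translation for each entry.  The result commutes with left
    translations and with the coboundary, and does not change when the entries
    are multiplied on the right by elements of a(Lam) (smear_rtrans).  It is
    homotopic to the identity: prism is the usual prism operator between the
    tuples (x_0, ..., x_n) and (x_0 l_0, ..., x_n l_n), averaged over the l_i
    (prism_homotopy).  Both operators are defined by recursion on the length of
    the tuple, which reduces the homotopy formula to a short induction.

    With H = Gam this is all that is needed.  With H = G one also needs that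
    smear and prism preserve continuity and that a smeared continuous function
    depends only on the cosets of the stabiliser U of the base point.  Here
    commensurability enters: it makes the orbits of Lam on X finite, so that U
    is compact (base_stab_compact); then, for a continuous f, the
    functions u |-> f (z u) on U depend continuously on z for the uniform norm,
    so that averages of f remain continuous by the bound on M
    (continuous_mean_rtrans).  Invariance under a(Lam) finally extends to U,
    where a(Lam) is dense (smear_rtrans_compact).

    A cochain f of Gam induces the cochain of G that evaluates the smeared f at
    representatives of the cosets of the arguments.  Restricting it to Gam gives
    back the smeared f, and inducing the restriction of a continuous cochain of
    G gives that cochain smeared over G.  Hence induction is an inverse of the
    restriction on cohomology. *)

Set Implicit Arguments.
Unset Strict Implicit.
Unset Printing Implicit Defensive.

Import Order.TTheory GRing.Theory Num.Theory.
Import numFieldNormedType.Exports.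
Local Open Scope classical_set_scope.
Local Open Scope ring_scope.

(** * An invariant mean for all functions on a locally finite group *)

(** A maximal subspace containing N and avoiding e is a complement of the line
    of e, and the wanted form is the coordinate along e.  Maximality is taken
    among the sets stable under linear combinations and under adding elements
    of N, a class closed under all unions of chains, the empty one included. *)
Lemma exists_linear_form (K : fieldType) (V : lmodType K) (N : set V) (e : V) :
  N 0 -> (forall a x y, N x -> N y -> N (a *: x + y)) -> ~ N e ->
  exists L : V -> K, [/\ forall a x y, L (a *: x + y) = a * L x + L y,
    forall x, N x -> L x = 0 & L e = 1].
Proof.
move=> N0 Nlin Ne.
pose P (A : set V) := [/\ forall a x y, A x -> A y -> A (a *: x + y),
  forall x y, N x -> A y -> A (x + y) & ~ A e].
have [|A [[Alin AN Ae] Amax]] := @Zorn_bigcup V P.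
  move=> F FP Ftot; split=> [a x y [B FB Bx] [C FC Cy]|x y Nx [B FB By]|[B FB]].
  - have [BC|CB] := Ftot _ _ FB FC.
      by exists C => //; have [+ _ _] := FP _ FC; apply=> //; exact: BC.
    by exists B => //; have [+ _ _] := FP _ FB; apply=> //; exact: CB.
  - by exists B => //; have [_ + _] := FP _ FB; apply.
  - by have [_ _] := FP _ FB.
have [A0|/set0P[y0 Ay0]] := eqVneq A set0.
  exfalso; apply: (Amax N); first by rewrite A0; split=> [x []|/(_ 0 N0) []].
  split=> // x y Nx Ny; rewrite -[x]scale1r; exact: Nlin.
have A00 : A 0 by have := Alin (-1) _ _ Ay0 Ay0; rewrite scaleN1r addNr.
have NA x : N x -> A x by move=> Nx; rewrite -[x]addr0; exact: AN.
have AZ a x : A x -> A (a *: x) by move=> Ax; rewrite -[_ *: _]addr0; exact: Alin.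
have AD x y : A x -> A y -> A (x + y) by move=> Ax Ay; rewrite -[x]scale1r; exact: Alin.
(* if v is not in A, then A + K v contains e by maximality *)
have split_line v : exists c, A (v - c *: e).
  have [Av|nAv] := pselect (A v); first by exists 0; rewrite scale0r subr0.
  pose B := [set w | exists c, A (w - c *: v)].
  have AB : A `<` B.
    split=> [x Ax|BA]; first by exists 0; rewrite scale0r subr0.
    by apply/nAv/BA; exists 1; rewrite scale1r subrr.
  have : B e.
    apply: contrapT => Be; apply: (Amax B AB); split=> //.
    - move=> a x y [c Ac] [d Ad]; exists (a * c + d).
      rewrite scalerDl -scalerA opprD addrACA -scalerBr; exact: Alin.
    - by move=> x y /NA Ax [c Ac]; exists c; rewrite -addrA; exact: AD.
  move=> [c Ac]; have c0 : c != 0.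
    by apply/eqP => c0; apply: Ae; move: Ac; rewrite c0 scale0r subr0.
  exists c^-1; have := AZ (- c^-1) _ Ac.
  by rewrite scaleNr scalerBr opprB scalerA mulVf // scale1r.
pose L v := xget 0 [set c | A (v - c *: e)].
have LA v : A (v - L v *: e).
  by apply: (@xgetPex _ 0 [set c | A (v - c *: e)]); exact: split_line.
have Luniq v c : A (v - c *: e) -> L v = c.
  move=> Ac; apply/eqP; apply: contrapT => /negP cL; apply: Ae.
  have : A ((L v - c) *: e).
    have := Alin (-1) _ _ (LA v) Ac.
    by rewrite scaleN1r opprB subrKA -scalerBl.
  by move/(AZ (L v - c)^-1); rewrite scalerA mulVf ?scale1r ?subr_eq0.
exists L; split=> [a x y|x Nx|]; apply: Luniq.
- by rewrite scalerDl -scalerA opprD addrACA -scalerBr; exact: Alin.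
- by rewrite scale0r subr0; exact: NA.
- by rewrite scale1r subrr.
Qed.

Section FiniteSubgroups.
Variables (Gam : groupType) (Lam : groupClosed Gam).

(** The generated subgroup as a boolean predicate, so that it can carry the
    structure of a subgroup to which local finiteness applies. *)
Definition gen_pred (S : set Gam) : {pred Gam} := fun x => `[< gen_subgroup S x >].

Lemma gen_predP (S : set Gam) x : reflect (gen_subgroup S x) (x \in gen_pred S).
Proof. exact: asboolP. Qed.

Lemma gen_pred1 (S : set Gam) : 1%g \in gen_pred S.
Proof. by apply/gen_predP => K _; exact: gpred1. Qed.

Lemma gen_predM (S : set Gam) : mulg_closed (gen_pred S).
Proof.
by move=> x y /gen_predP Sx /gen_predP Sy; apply/gen_predP => K SK;
  apply: gpredM; [exact: Sx | exact: Sy].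
Qed.

Lemma gen_predV (S : set Gam) : invg_closed (gen_pred S).
Proof.
by move=> x /gen_predP Sx; apply/gen_predP => K SK; rewrite gpredV; exact: Sx.
Qed.

HB.instance Definition _ S := isMulClosed.Build Gam (gen_pred S) (@gen_predM S).
HB.instance Definition _ S := isMul1Closed.Build Gam (gen_pred S) (@gen_pred1 S).
HB.instance Definition _ S := isInvClosed.Build Gam (gen_pred S) (@gen_predV S).

(** Stability under products suffices, a finite submonoid of a group being a
    subgroup. *)
Definition finite_subgroup (s : seq Gam) : Prop :=
  [/\ uniq s, 1%g \in s, {subset s <= Lam} & {in s &, forall x y, (x * y)%g \in s}].

Lemma sub_finite_subgroup (S : seq Gam) : locally_finite Lam -> {subset S <= Lam} ->
  exists2 s, finite_subgroup s & {subset S <= s}.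
Proof.
move=> lf SL; pose H : groupClosed Gam := gen_pred [set` S].
have HE : [set` H] = gen_subgroup [set` S].
  by apply/seteqP; split=> x /gen_predP.
have SH : [set` S] `<=` [set` H] by move=> x Sx; apply/gen_predP => K; apply.
have HL : [set` H] `<=` [set` Lam].
  by rewrite HE => x; apply; move=> y Sy; exact: SL.
have /finite_seqP[s Es] : finite_set [set` H].
  by apply: lf => //; rewrite HE; exists [set` S] => //; exact: finite_seq.
have memE x : (x \in undup s) = (x \in H).
  rewrite mem_undup; apply/idP/idP => [xs|xH].
    by have : [set` s] x := xs; rewrite -Es.
  by have : [set` H] x := xH; rewrite Es.
exists (undup s); last by move=> x xS; rewrite memE; exact: SH.
split; first exact: undup_uniq.
- by rewrite memE gpred1.
- by move=> x; rewrite memE; exact: HL.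
- by move=> x y; rewrite !memE; exact: gpredM.
Qed.
End FiniteSubgroups.

Section Mean.
Variables (R : realType) (Gam : groupType) (Lam : groupClosed Gam).

Definition average (s : seq Gam) (phi : Gam -> R) : R :=
  (\sum_(x <- s) phi x) / (size s)%:R.

Lemma averageP s a phi psi :
  average s (fun x => a * phi x + psi x) = a * average s phi + average s psi.
Proof. by rewrite /average big_split /= -mulr_sumr mulrDl mulrA. Qed.

Section Subgroup.
Variables (s : seq Gam) (sL : finite_subgroup Lam s).

Let size_neq0 : (size s)%:R != 0 :> R.
Proof. by have [_ + _ _] := sL; case: (s) => //= *; rewrite pnatr_eq0. Qed.

Lemma average_cst c : average s (fun=> c) = c.
Proof.
by rewrite /average big_const_seq count_predT iter_addr_0 -[c *+ _]mulr_natr mulfK.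
Qed.

(** Multiplication by an element of a finite subgroup permutes the subgroup. *)
Lemma average_mull m phi : m \in s ->
  average s (fun x => phi (m * x)%g) = average s phi.
Proof.
move=> ms; have [us _ _ sM] := sL; rewrite /average; congr (_ / _).
rewrite -(big_map (fun x => m * x)%g predT); apply: perm_big.
have um : uniq (map (fun x => m * x)%g s) by rewrite map_inj_uniq //; exact: mulgI.
apply: uniq_perm => //; apply: (uniq_min_size um _ _).2; last by rewrite size_map.
by move=> _ /mapP[x xs ->]; exact: sM.
Qed.

Lemma average_bound e phi :
  (forall x, x \in Lam -> `|phi x| <= e) -> `|average s phi| <= e.
Proof.
move=> phie; have [_ _ sLam _] := sL.
rewrite normrM normfV normr_nat ler_pdivrMr ?lt0r ?size_neq0 ?ler0n //.
apply: le_trans (ler_norm_sum _ _ _) _.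
rewrite mulr_natr -[size s]count_predT -iter_addr_0 -big_const_seq.
by rewrite big_seq [leRHS]big_seq; apply: ler_sum => x /sLam; exact: phie.
Qed.
End Subgroup.

(** The functions are defined on the whole group, but by mean_bound only their
    restrictions to the subgroup matter. *)
Record mean := Mean {
  mean_fun :> (Gam -> R) -> R ;
  meanP : forall a phi psi,
    mean_fun (fun x => a * phi x + psi x) = a * mean_fun phi + mean_fun psi ;
  mean_cst : forall c, mean_fun (fun=> c) = c ;
  mean_mull : forall m phi, m \in Lam ->
    mean_fun (fun x => phi (m * x)%g) = mean_fun phi ;
  mean_bound : forall e phi,
    (forall x, x \in Lam -> `|phi x| <= e) -> `|mean_fun phi| <= e }.

(** The ultrafilter lives on the finite subgroups of Lam, listed as sequences,
    and contains for each finite S the set of those that include S; local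
    finiteness says that such sets are nonempty. *)
Lemma mean_exists : locally_finite Lam -> inhabited mean.
Proof.
move=> lf; pose F := filter_from [set S : seq Gam | {subset S <= Lam}]
  (fun S => [set s | finite_subgroup Lam s /\ {subset S <= s}]).
have PF : ProperFilter F.
  apply: filter_from_proper; last first.
    by move=> S /(sub_finite_subgroup lf)[s sL Ss]; exists s.
  apply: filter_from_filter; first by exists [::].
  move=> S T SL TL; exists (S ++ T).
    by move=> x; rewrite mem_cat => /orP[/SL|/TL].
  move=> s [sL STs]; split; split=> // x xS; apply: STs.
    by rewrite mem_cat xS.
  by rewrite mem_cat xS orbT.
have [U [UU FU]] := ultraFilterLemma PF; have PU : ProperFilter U := ultra_proper.
have Usub (S : seq Gam) : {subset S <= Lam} ->
    \forall s \near U, finite_subgroup Lam s /\ {subset S <= s}.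
  by move=> SL; apply: FU; exists S.
have Ufin : \forall s \near U, finite_subgroup Lam s.
  have : {subset (@nil Gam) <= Lam} by [].
  by move=> /Usub; apply: filterS => s [].
pose V : lmodType R := (Gam -> R^o).
(* the averages of an unbounded function need not converge: N is only a
   subspace, and the form is extended to all functions by maximality *)
pose N := [set phi : V | (fun s => average s phi : R^o) @ U --> (0 : R^o)].
have cvgN (phi : V) c : (forall s, finite_subgroup Lam s -> average s phi = c) ->
    (fun s => average s phi : R^o) @ U --> (c : R^o).
  move=> avg; apply: (@cvg_trans _ ((fun=> c : R^o) @ U)); last exact: cvg_cst.
  by apply: near_eq_cvg; apply: filterS Ufin => s /avg ->.
have [|||L [LP LN L1]] := @exists_linear_form R V N (fun=> 1).
- by apply: cvgN => s sL; exact: average_cst.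
- move=> a x y Nx Ny.
  have : (fun s => a * average s x + average s y : R^o) @ U --> (a * 0 + 0 : R^o).
    by apply: cvgD => //; apply: cvgM => //; exact: cvg_cst.
  rewrite mulr0 addr0; apply: cvg_trans; apply: near_eq_cvg.
  by apply: nearW => s; rewrite -averageP.
- move=> N1; have C1 : (fun s => average s (fun=> 1) : R^o) @ U --> (1 : R^o).
    by apply: cvgN => s sL; exact: average_cst.
  have E : (1 : R^o) = 0 by apply: norm_cvg_unique C1 N1.
  by move/eqP: E; rewrite oner_eq0.
have Lsub phi psi : L (fun x => phi x - psi x) = L phi - L psi.
  rewrite [RHS]addrC -mulN1r -LP; congr (L _).
  by apply/funext => x; rewrite [RHS]/(-1 * psi x + phi x) mulN1r addrC.
have Lcst c : L (fun=> c) = c.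
  have L0 : L (fun=> 0) = 0 by apply: LN; apply: cvgN => s sL; exact: average_cst.
  transitivity (c * L (fun=> 1) + L (fun=> 0)); last by rewrite L1 L0 mulr1 addr0.
  rewrite -LP; congr (L _).
  by apply/funext => x; rewrite -[RHS]/(c * 1 + 0) mulr1 addr0.
constructor; exists L => //.
- move=> m phi mL; apply/eqP; rewrite -subr_eq0 -Lsub; apply/eqP/LN.
  have mS : {subset [:: m] <= Lam} by move=> x; rewrite inE => /eqP ->.
  apply: (@cvg_trans _ ((fun=> 0 : R^o) @ U)); last exact: cvg_cst.
  apply: near_eq_cvg; apply: filterS (Usub _ mS) => s [sL ms].
  have := averageP s (-1) phi (fun x => phi (m * x)%g).
  rewrite (average_mull sL) ?ms ?mem_head // mulN1r addNr => <-.
  by congr average; apply/funext => x; rewrite mulN1r addrC.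
- move=> e phi phie.
  have Ue : \forall s \near U, average s phi \in `[- e, e].
    apply: filterS Ufin => s sL; rewrite in_itv /= -ler_norml.
    exact: average_bound.
  have [l [lI lcl]] := @segment_compact R (- e) e ((fun s => average s phi : R^o) @ U)
    _ Ue.
  (* l is a cluster point, hence a limit along the ultrafilter *)
  suff -> : L phi = l by move: lI; rewrite /= in_itv /= -ler_norml.
  apply/eqP; rewrite -[X in _ == X]Lcst -subr_eq0 -Lsub; apply/eqP/LN.
  have cl : (fun s => average s phi : R^o) @ U --> (l : R^o).
    move=> B lB.
    have [//|UB] :=
      in_ultra_setVsetC ((fun s => average s phi : R^o) @^-1` B) UU.
    by have [x []] := lcl (~` B) B UB lB.
  apply: (@cvg_trans _ ((fun s => (average s phi : R^o) - l) @ U)).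
    apply: near_eq_cvg; apply: filterS Ufin => s sL.
    have := averageP s (-1) (fun=> l) phi.
    rewrite (average_cst sL) mulN1r addrC => <-.
    by congr average; apply/funext => x; rewrite addrC.
  by rewrite -(subrr l); apply: cvgB => //; exact: cvg_cst.
Qed.
End Mean.

Section MeanTheory.
Variables (R : realType) (Gam : groupType) (Lam : groupClosed Gam).
Variable M : mean R Lam.

Lemma meanB phi psi : M (fun l => phi l - psi l) = M phi - M psi.
Proof.
rewrite [RHS]addrC -mulN1r -meanP; congr (M _).
by apply/funext => l; rewrite mulN1r addrC.
Qed.

Lemma mean_sumZ (I : Type) (r : seq I) (c : I -> R) (phi : I -> Gam -> R) :
  M (fun l => \sum_(i <- r) c i * phi i l) = \sum_(i <- r) c i * M (phi i).
Proof.
elim: r => [|i r IH].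
  by under eq_fun do rewrite big_nil; rewrite mean_cst big_nil.
by under eq_fun do rewrite big_cons; rewrite meanP IH big_cons.
Qed.
End MeanTheory.

(** * Averaging cochains and the prism homotopy *)

Section TupleOps.
Variable H : Type.

Definition fcons n (z : H) (y : 'I_n -> H) : 'I_n.+1 -> H :=
  fun i => if unlift ord0 i is Some j then y j else z.

Definition ftail n (x : 'I_n.+1 -> H) : 'I_n -> H := fun j => x (lift ord0 j).

Lemma fcons0 n z (y : 'I_n -> H) : fcons z y ord0 = z.
Proof. by rewrite /fcons unlift_none. Qed.

Lemma fconsS n z (y : 'I_n -> H) j : fcons z y (lift ord0 j) = y j.
Proof. by rewrite /fcons liftK. Qed.

Lemma ftailK n z (y : 'I_n -> H) : ftail (fcons z y) = y.
Proof. by apply/funext => j; exact: fconsS. Qed.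

Lemma fcons_eta n (x : 'I_n.+1 -> H) : fcons (x ord0) (ftail x) = x.
Proof.
by apply/funext => i; case: (unliftP ord0 i) => [j|] ->; rewrite (fconsS, fcons0).
Qed.

End TupleOps.

Lemma comp_fcons (H K : Type) (u : H -> K) n z (y : 'I_n -> H) :
  u \o fcons z y = fcons (u z) (u \o y).
Proof. by apply/funext => i; rewrite /fcons /=; case: unlift. Qed.

Section Coboundary.
Variables (R : comNzRingType) (H : Type).

(** The homogeneous differential, here on arbitrary functions and also in
    augmented degree, where n = 0. *)
Definition altsum n (f : ('I_n -> H) -> R) : ('I_n.+1 -> H) -> R :=
  fun x => \sum_(i < n.+1) (-1) ^+ i * f (fun j => x (lift i j)).

Lemma altsum0 (f : ('I_0 -> H) -> R) x : altsum f x = f (ftail x).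
Proof. by rewrite /altsum big_ord1 expr0 mul1r. Qed.

(** The form in which the differential enters all the inductions on the length
    of the tuple. *)
Lemma altsumS n (f : ('I_n.+1 -> H) -> R) x :
  altsum f x = f (ftail x) - altsum (f \o fcons (x ord0)) (ftail x).
Proof.
rewrite /altsum big_ord_recl expr0 mul1r -sumrN; congr (_ + _).
apply: eq_bigr => i _; rewrite exprS mulN1r mulNr; congr (- (_ * f _)).
apply/funext => j; case: (unliftP ord0 j) => [k|] ->.
  by rewrite fconsS /ftail; congr (x _); apply: val_inj; rewrite /= bumpS.
by rewrite fcons0; congr (x _); apply: val_inj.
Qed.

Lemma altsumB n (f g : ('I_n -> H) -> R) x :
  altsum (fun y => f y - g y) x = altsum f x - altsum g x.
Proof.
by rewrite /altsum -sumrB; apply: eq_bigr => i _; rewrite mulrBr.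
Qed.

End Coboundary.

Section Averaging.
Variables (R : realType) (Gam : groupType) (Lam : groupClosed Gam).
Variables (M : mean R Lam) (H : groupType) (a : Gam -> H).

(** The mean of f (x_0 a(l_0), ..., x_(n-1) a(l_(n-1))) over l_0, ..., l_(n-1),
    as an iterated mean with l_0 outermost. *)
Fixpoint smear n : (('I_n -> H) -> R) -> ('I_n -> H) -> R :=
  match n with
  | 0 => fun f => f
  | n'.+1 => fun f x =>
      M (fun l => @smear n' (f \o fcons (x ord0 * a l)%g) (ftail x))
  end.

(** Unfolded, the alternating sum over i of the means of
    f (x_0, ..., x_i, x_i a(l_i), ..., x_(n-1) a(l_(n-1))) over the l's. *)
Fixpoint prism n : (('I_n.+1 -> H) -> R) -> ('I_n -> H) -> R :=
  match n with
  | 0 => fun _ _ => 0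
  | n'.+1 => fun f x =>
      smear (f \o fcons (x ord0)) x - @prism n' (f \o fcons (x ord0)) (ftail x)
  end.

Lemma smear0 (f : ('I_0 -> H) -> R) x : smear f x = f x.
Proof. by []. Qed.

Lemma smearS n (f : ('I_n.+1 -> H) -> R) x :
  smear f x = M (fun l => smear (f \o fcons (x ord0 * a l)%g) (ftail x)).
Proof. by []. Qed.

Lemma prismS n (f : ('I_n.+2 -> H) -> R) x :
  prism f x = smear (f \o fcons (x ord0)) x - prism (f \o fcons (x ord0)) (ftail x).
Proof. by []. Qed.

Arguments smear : simpl never.
Arguments prism : simpl never.

Lemma smearP n c (f g : ('I_n -> H) -> R) x :
  smear (fun y => c * f y + g y) x = c * smear f x + smear g x.
Proof.
elim: n f g x => [|n IH] f g x //; rewrite !smearS -meanP; congr (M _).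
by apply/funext => l; rewrite -IH.
Qed.

Lemma smearB n (f g : ('I_n -> H) -> R) x :
  smear (fun y => f y - g y) x = smear f x - smear g x.
Proof.
elim: n f g x => [|n IH] f g x //; rewrite !smearS -meanB; congr (M _).
by apply/funext => l; rewrite -IH.
Qed.

Lemma prismB n (f g : ('I_n.+1 -> H) -> R) x :
  prism (fun y => f y - g y) x = prism f x - prism g x.
Proof.
elim: n f g x => [|n IH] f g x; first by rewrite /prism subrr.
rewrite -[LHS]/(smear (fun y => (f \o fcons (x ord0)) y - (g \o fcons (x ord0)) y) x
  - prism (fun y => (f \o fcons (x ord0)) y - (g \o fcons (x ord0)) y) (ftail x)).
by rewrite smearB IH !prismS; ring.
Qed.

Lemma prism_cst0 n x : prism (fun _ : 'I_n.+1 -> H => 0) x = 0.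
Proof.
rewrite -[RHS](subrr (prism (fun _ => 0) x)) -prismB; congr (prism _ _).
by apply/funext => y; rewrite subrr.
Qed.

Lemma altsum_mean n (f : Gam -> ('I_n -> H) -> R) x :
  altsum (fun y => M (fun l => f l y)) x = M (fun l => altsum (f l) x).
Proof. by rewrite /altsum mean_sumZ. Qed.

Lemma altsum_comp_fcons n (f : ('I_n.+1 -> H) -> R) z :
  altsum f \o fcons z = fun y => f y - altsum (f \o fcons z) y.
Proof. by apply/funext => y /=; rewrite altsumS ftailK fcons0. Qed.

Lemma smear_fcons n (f : ('I_n.+1 -> H) -> R) z :
  smear f \o fcons z = fun y => M (fun l => smear (f \o fcons (z * a l)%g) y).
Proof. by apply/funext => y; rewrite /comp smearS fcons0 ftailK. Qed.

Lemma prism_fcons n (f : ('I_n.+2 -> H) -> R) z :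
  prism f \o fcons z =
  fun y => (smear (f \o fcons z) \o fcons z) y - prism (f \o fcons z) y.
Proof. by apply/funext => y; rewrite /comp prismS fcons0 ftailK. Qed.

Lemma smear_altsum n (f : ('I_n -> H) -> R) x :
  smear (altsum f) x = altsum (smear f) x.
Proof.
elim: n f x => [|n IH] f x.
  rewrite altsum0 smearS smear0 -[RHS](mean_cst M); congr (M _).
  by apply/funext => l; rewrite smear0 /= altsum0 ftailK.
rewrite altsumS smear_fcons altsum_mean -(mean_cst M (smear f (ftail x))).
rewrite -meanB smearS; congr (M _); apply/funext => l.
by rewrite altsum_comp_fcons smearB IH.
Qed.

(** Freezing x_0 reduces the formula for f to the one for f (x_0, -).  The terms
    left over cancel because smear commutes with the differential. *)
Lemma prism_homotopy n (f : ('I_n.+1 -> H) -> R) x :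
  altsum (prism f) x + prism (altsum f) x = smear f x - f x.
Proof.
elim: n f x => [|n IH] f x.
  rewrite altsum0 add0r prismS [prism _ (ftail x)]/prism subr0.
  rewrite altsum_comp_fcons smearB smear_altsum altsum0 smear0 /=.
  by rewrite fcons_eta.
rewrite altsumS [prism (altsum f) x]prismS altsum_comp_fcons smearB prismB.
rewrite smear_altsum altsumS prism_fcons altsumB.
have := IH (f \o fcons (x ord0)) (ftail x); rewrite [(_ \o _) (ftail x)]/= fcons_eta.
move=> /(canRL (addKr _)) ->; ring.
Qed.

Definition ltrans n (g : H) (x : 'I_n -> H) : 'I_n -> H := fun i => (g * x i)%g.

Lemma ltrans_fcons n g z (y : 'I_n -> H) :
  ltrans g (fcons z y) = fcons (g * z)%g (ltrans g y).
Proof. exact: comp_fcons. Qed.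

Lemma smear_ltrans n g (f : ('I_n -> H) -> R) x :
  smear f (ltrans g x) = smear (f \o ltrans g) x.
Proof.
elim: n f x => [|n IH] f x //; rewrite !smearS; congr (M _); apply/funext => l.
rewrite -[ftail _]/(ltrans g (ftail x)) IH; congr (smear _ _).
by apply/funext => y /=; rewrite ltrans_fcons /ltrans mulgA.
Qed.

Lemma prism_ltrans n g (f : ('I_n.+1 -> H) -> R) x :
  prism f (ltrans g x) = prism (f \o ltrans g) x.
Proof.
elim: n f x => [|n IH] f x //; rewrite !prismS.
rewrite -[ftail _]/(ltrans g (ftail x)) IH smear_ltrans.
have -> : f \o fcons (ltrans g x ord0) \o ltrans g = f \o ltrans g \o fcons (x ord0).
  by apply/funext => y /=; rewrite ltrans_fcons.
by [].
Qed.

Hypothesis aM : {morph a : g k / (g * k)%g}.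

(** Each entry is absorbed by the left invariance of the mean attached to it,
    the inner ones first by induction. *)
Lemma smear_rtrans n (f : ('I_n -> H) -> R) x y :
  (forall i, exists2 m, m \in Lam & y i = (x i * a m)%g) -> smear f y = smear f x.
Proof.
elim: n f x y => [|n IH] f x y xy; first by congr (f _); apply/funext => -[].
have [m mL xy0] := xy ord0; rewrite !smearS xy0 -[RHS](mean_mull M _ mL); congr (M _).
by apply/funext => l; rewrite aM mulgA; apply: IH => i; exact: xy.
Qed.

End Averaging.

(** Smearing is natural in the group: this compares the averages on Gam with
    those on its completion. *)
Lemma smear_comp (R : realType) (Gam : groupType) (Lam : groupClosed Gam)
    (M : mean R Lam) (H K : groupType) (a : Gam -> H) (b : H -> K) n
    (bM : {morph b : g k / (g * k)%g}) (f : ('I_n -> K) -> R) x :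
  smear M (b \o a) f (b \o x) = smear M a (fun y => f (b \o y)) x.
Proof.
elim: n f x => [|n IH] f x //; rewrite !smearS; congr (M _); apply/funext => l.
rewrite -[ftail _]/(b \o ftail x) IH; congr (smear _ _ _ _).
by apply/funext => y /=; rewrite comp_fcons bM.
Qed.

(** * Continuity of averages over a subgroup with compact closure *)

Lemma continuous_pair (S T1 T2 : topologicalType) (f : S -> T1) (g : S -> T2) :
  continuous f -> continuous g -> continuous (fun s => (f s, g s)).
Proof. by move=> cf cg s; apply: cvg_pair; [exact: cf | exact: cg]. Qed.

Lemma continuous_compose (S T1 T2 : topologicalType) (f : S -> T1) (g : T1 -> T2) :
  continuous f -> continuous g -> continuous (fun s => g (f s)).
Proof. by move=> cf cg s; apply: continuous_comp; [exact: cf | exact: cg]. Qed.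

Lemma continuous_id (T : topologicalType) : continuous (fun x : T => x).
Proof. by move=> x; exact: cvg_id. Qed.

Lemma continuous_fst (S T : topologicalType) : continuous (@fst S T).
Proof. by move=> p; exact: cvg_fst. Qed.

Lemma continuous_snd (S T : topologicalType) : continuous (@snd S T).
Proof. by move=> p; exact: cvg_snd. Qed.

Lemma continuous_fst_fst (A B C : topologicalType) :
  continuous (fun q : (A * B) * C => q.1.1).
Proof. exact: continuous_compose (@continuous_fst _ C) (@continuous_fst A B). Qed.

Lemma continuous_fst_snd (A B C : topologicalType) :
  continuous (fun q : (A * B) * C => q.1.2).
Proof. exact: continuous_compose (@continuous_fst _ C) (@continuous_snd A B). Qed.

Section TupleTopology.
Variable G : topologicalGroupType.

Lemma near_tuples n (x : tuples G n) (P : 'I_n -> set G) :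
  (forall i, nbhs (x i) (P i)) -> \forall z \near x, forall i, P i (z i).
Proof.
move=> xP; apply: (@filter_forall (tuples G n) _ (fun i z => P i (z i)) (nbhs x)) => i.
exact: (@proj_continuous _ (fun=> G) i x _ (xP i)).
Qed.

Lemma continuous_tuples (T : topologicalType) n (u : T -> tuples G n) :
  (forall i, continuous (fun t => u t i)) -> continuous u.
Proof.
move=> cu t; have FF : Filter (u @ t) by apply: fmap_filter; exact: nbhs_filter.
apply/cvg_sup => i A [_ [[B oB <-] /= Bu sBA]].
by apply: (filterS sBA); apply: (cu i t); exact: open_nbhs_nbhs.
Qed.

Lemma continuous_coord n i : continuous (fun x : tuples G n => x i).
Proof. by move=> x; exact: (@proj_continuous _ (fun=> G) i x). Qed.

Lemma continuous_ftail n : continuous (@ftail G n : tuples G n.+1 -> tuples G n).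
Proof. by apply: continuous_tuples => i; exact: continuous_coord. Qed.

Lemma continuous_fcons n :
  continuous (fun p : G * tuples G n => fcons p.1 p.2 : tuples G n.+1).
Proof.
apply: continuous_tuples => i; case: (unliftP ord0 i) => [j|] ->.
  rewrite (_ : (fun p => _) = (fun p : G * tuples G n => p.2 j)); last first.
    by apply/funext => p; exact: fconsS.
  move=> p; apply: (@continuous_comp _ _ _ snd (fun x : tuples G n => x j)).
    exact: cvg_snd.
  exact: continuous_coord.
rewrite (_ : (fun p => _) = (fun p : G * tuples G n => p.1)); last first.
  by apply/funext => p; exact: fcons0.
by move=> p; exact: cvg_fst.
Qed.

Lemma continuous_fcons_curry (S T : topologicalType) n (F : T -> tuples G n.+1 -> S) :
  continuous (fun p : T * tuples G n.+1 => F p.1 p.2) ->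
  continuous (fun p : (T * G) * tuples G n => F p.1.1 (fcons p.1.2 p.2)).
Proof.
move=> cF.
have cc : continuous (fun p : (T * G) * tuples G n => fcons p.1.2 p.2 : tuples G n.+1).
  exact: continuous_compose
    (continuous_pair (@continuous_fst_snd T G _) (@continuous_snd _ _))
    (@continuous_fcons n).
exact: continuous_compose (continuous_pair (@continuous_fst_fst T G _) cc) cF.
Qed.

Lemma cvg_mulg (T : Type) (F : set_system T) {FF : Filter F} (f g : T -> G) x y :
  f @ F --> x -> g @ F --> y -> (fun t => f t * g t)%g @ F --> (x * y)%g.
Proof.
move=> fx gy; apply: (@cvg_comp _ _ _ (fun t => (f t, g t)) (fun p => p.1 * p.2)%g).
  exact: cvg_pair fx gy.
exact: (@mulg_continuous G (x, y)).
Qed.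

End TupleTopology.

Section CompactAveraging.
Variables (R : realType) (Gam : groupType) (Lam : groupClosed Gam) (M : mean R Lam).
Variables (G : topologicalGroupType) (a : Gam -> G) (U : set G).
Hypotheses (cU : compact U) (aU : forall l, l \in Lam -> U (a l)).

(** By compactness, near (t0, z0) the functions K (t, z u) and K (t0, z0 u) of u
    are within e of each other on all of U; the bound on the mean then applies
    to their difference. *)
Lemma continuous_mean_rtrans (T : topologicalType) (K : T * G -> R) : continuous K ->
  continuous (fun p : T * G => M (fun l => K (p.1, p.2 * a l)%g)).
Proof.
move=> cK [t0 z0]; apply/cvgrPdist_le => e e0 /=.
have : \forall p \near (t0, z0), U `<=`
    (fun u => `|K (t0, z0 * u)%g - K (p.1, p.2 * u)%g| <= e).
  apply: ((compact_near_coveringP U).1 cU _ (nbhs (t0, z0))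
    (fun p u => `|K (t0, z0 * u)%g - K (p.1, p.2 * u)%g| <= e)) => u Uu.
  have cD : (fun q : G * (T * G) => K (t0, z0 * q.1)%g - K (q.2.1, q.2.2 * q.1)%g) @
      (u, (t0, z0)) --> K (t0, z0 * u)%g - K (t0, z0 * u)%g.
    apply: cvgB.
      apply: (@cvg_comp _ _ _ (fun q : G * (T * G) => (t0, z0 * q.1)%g) K);
        last exact: cK.
      apply: cvg_pair; first exact: cvg_cst.
      by apply: cvg_mulg; [exact: cvg_cst | exact: cvg_fst].
    apply: (@cvg_comp _ _ _ (fun q : G * (T * G) => (q.2.1, q.2.2 * q.1)%g) K);
      last exact: cK.
    apply: cvg_pair.
      by apply: (@cvg_comp _ _ _ snd fst); [exact: cvg_snd | exact: cvg_fst].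
    apply: cvg_mulg; last exact: cvg_fst.
    by apply: (@cvg_comp _ _ _ snd snd); [exact: cvg_snd | exact: cvg_snd].
  move/cvgrPdist_le: cD => /(_ e e0); apply: filterS => -[v p] /=.
  by rewrite subrr sub0r normrN.
apply: filterS => -[t z] Utz; rewrite -meanB; apply: mean_bound => l lL.
exact: (Utz _ (aU lL)).
Qed.

(** The parameter t lets the induction freeze the first entry. *)
Lemma continuous_smear n (T : topologicalType) (F : T -> tuples G n -> R) :
  continuous (fun p : T * tuples G n => F p.1 p.2) ->
  continuous (fun p : T * tuples G n => smear M a (F p.1) p.2).
Proof.
elim: n T F => [|n IH] T F cF //; have cFc := continuous_fcons_curry cF.
have {}IH := IH _ (fun q : T * G => F q.1 \o fcons q.2) cFc.
(* the entry that is averaged first has to be moved to the last place *)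
have cK : continuous
    (fun q : (T * tuples G n) * G => smear M a (F q.1.1 \o fcons q.2) q.1.2).
  exact: continuous_compose (continuous_pair (continuous_pair
    (@continuous_fst_fst T (tuples G n) G) (@continuous_snd _ _))
    (@continuous_fst_snd _ _ _)) IH.
have ct : continuous (fun p : T * tuples G n.+1 => ftail p.2 : tuples G n).
  exact: continuous_compose (@continuous_snd T _) (@continuous_ftail G n).
have c0 : continuous (fun p : T * tuples G n.+1 => p.2 ord0).
  exact: continuous_compose (@continuous_snd T _) (@continuous_coord G n.+1 ord0).
exact: continuous_compose (continuous_pair (continuous_pair
  (@continuous_fst T (tuples G n.+1)) ct) c0) (continuous_mean_rtrans cK).
Qed.

Lemma continuous_prism n (T : topologicalType) (F : T -> tuples G n.+1 -> R) :
  continuous (fun p : T * tuples G n.+1 => F p.1 p.2) ->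
  continuous (fun p : T * tuples G n => prism M a (F p.1) p.2).
Proof.
elim: n T F => [|n IH] T F cF; first by move=> p; exact: cvg_cst.
have cFc := continuous_fcons_curry cF.
have {}IH := IH _ (fun q : T * G => F q.1 \o fcons q.2) cFc.
have cS := continuous_smear (F := fun q : T * G => F q.1 \o fcons q.2) cFc.
have ct : continuous (fun p : T * tuples G n.+1 => ftail p.2 : tuples G n).
  exact: continuous_compose (@continuous_snd T _) (@continuous_ftail G n).
have c0 : continuous (fun p : T * tuples G n.+1 => (p.1, p.2 ord0)).
  apply: continuous_pair; first exact: continuous_fst.
  exact: continuous_compose (@continuous_snd T _) (@continuous_coord G n.+1 ord0).
move=> p; apply: cvgB.
  exact: (continuous_compose (continuous_pair c0 (@continuous_snd T _)) cS).
exact: (continuous_compose (continuous_pair c0 ct) IH).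
Qed.

Lemma prism_continuous n (f : tuples G n.+1 -> R) : continuous f ->
  continuous (prism M a f : tuples G n -> R).
Proof.
move=> cf; have c1 : continuous (fun x : tuples G n => (1%g : G, x)).
  by apply: continuous_pair; [exact: cst_continuous | exact: continuous_id].
apply: (continuous_compose c1 (@continuous_prism n G (fun=> f) _)).
exact: continuous_compose (@continuous_snd G _) cf.
Qed.

Hypothesis aM : {morph a : g k / (g * k)%g}.
Hypothesis UL : U `<=` closure (a @` [set` Lam]).

(** Translating by elements of a(Lam) does not change the mean, and the mean
    depends continuously on the translation. *)
Lemma mean_rtrans_compact (k : G -> R) x u : continuous k -> U u ->
  M (fun l => k (x * u * a l)%g) = M (fun l => k (x * a l)%g).
Proof.
move=> ck Uu; pose g (z : G) := M (fun l => k (z * a l)%g).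
have cg : continuous g.
  have c1 : continuous (fun z : G => (z, z)).
    by apply: continuous_pair; exact: continuous_id.
  apply: (continuous_compose c1 (@continuous_mean_rtrans G (fun p => k p.2) _)).
  exact: continuous_compose (@continuous_snd G _) ck.
have gx m : m \in Lam -> g (x * a m)%g = g x.
  move=> mL; rewrite /g -[RHS](mean_mull M _ mL); congr (M _).
  by apply/funext => l; rewrite aM mulgA.
apply/eqP; rewrite -subr_eq0 -normr_le0; apply/ler_addgt0Pl => e e0; rewrite addr0.
have cgx : (fun v => g (x * v)%g) @ u --> g (x * u)%g.
  apply: (@cvg_comp _ _ _ (fun v => x * v)%g g); last exact: cg.
  by apply: cvg_mulg; [exact: cvg_cst | exact: cvg_id].
move/cvgrPdist_le: cgx => /(_ e e0) near_u.
have [_ [[m mL <-] /=]] := UL Uu near_u.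
by rewrite gx.
Qed.

Lemma smear_rtrans_compact n (f : tuples G n -> R) (x y : tuples G n) : continuous f ->
  (forall i, U ((x i)^-1 * y i)%g) -> smear M a f y = smear M a f x.
Proof.
elim: n f x y => [|n IH] f x y cf xy; first by congr (f _); apply/funext => -[].
rewrite !smearS.
have cfc z : continuous (f \o fcons z : tuples G n -> R).
  have c1 : continuous (fun y : tuples G n => (z, y)).
    by apply: continuous_pair; [exact: cst_continuous | exact: continuous_id].
  exact: continuous_compose (continuous_compose c1 (@continuous_fcons G n)) cf.
transitivity (M (fun l => smear M a (f \o fcons (y ord0 * a l)%g) (ftail x))).
  congr (M _); apply/funext => l; apply: IH; first exact: cfc.
  by move=> i; exact: xy.
rewrite -[y ord0](mulVKg (x ord0)).
apply: (@mean_rtrans_compact (fun z => smear M a (f \o fcons z) (ftail x))) => //.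
have c1 : continuous (fun z : G => (z, ftail x : tuples G n)).
  by apply: continuous_pair; [exact: continuous_id | exact: cst_continuous].
apply: (continuous_compose c1 (@continuous_smear n G (fun z => f \o fcons z) _)).
exact: continuous_compose (@continuous_fcons G n) cf.
Qed.

End CompactAveraging.

(** * The compact stabiliser of the base point of the completion *)

Lemma ultra_finite_const (T : Type) (X : eqType) (F : set_system T)
    (phi : T -> X) (r : seq X) :
  UltraFilter F -> (\forall t \near F, phi t \in r) ->
  exists x, \forall t \near F, phi t = x.
Proof.
move=> UF; have PF : ProperFilter F := ultra_proper.
elim: r => [|x r IH] Fr; first by have [t] := filter_ex Fr.
have [Fx|Fx] := in_ultra_setVsetC [set t | phi t = x] UF; first by exists x.
apply: IH; apply: filterS2 Fr Fx => t.
by rewrite inE => /orP[/eqP|].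
Qed.

Section SchlichtingTopology.
Variables (Gam : groupType) (Lam : groupClosed Gam).
Local Open Scope quotient_scope.
Local Notation G := (schlichting Lam).
Local Notation X := (coset_space Lam).
Local Notation a := (schlichting_hom Lam).

Definition base : X := \pi_X 1%g.

Definition base_stab : set G := [set s | (val s : Sym X) base = base].

Lemma lmul_coset_base g : @lmul_coset _ Lam g base = \pi_X g.
Proof. by rewrite lmul_coset_pi mulg1. Qed.

Lemma pi_cosetP x y : reflect (\pi_X x = \pi_X y) ((x^-1 * y)%g \in Lam).
Proof. by apply: (iffP idP) => [?|/eqP]; [apply/eqP|]; rewrite eqmodE. Qed.

Lemma schlichting_near (s : G) (x : X) :
  \forall t \near s, (val t : Sym X) x = (val s : Sym X) x.
Proof. exact: (image_closure_val_continuous (nbhs_sym (val s) x)). Qed.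

(** Density of Gam for the topology of pointwise convergence: any element of
    the completion agrees with one of Gam on finitely many cosets. *)
Lemma schlichting_approx (s : G) n (c : 'I_n -> X) (B : set G) : nbhs s B ->
  exists2 g, B (a g) & forall i, @lmul_coset _ Lam g (c i) = (val s : Sym X) (c i).
Proof.
move=> [_ [[B' oB' <-] B's sB]].
have : \forall t \near (val s : Sym X),
    B' t /\ forall i, t (c i) = (val s : Sym X) (c i).
  apply: filterI; first exact: open_nbhs_nbhs.
  apply: (@filter_forall _ _ (fun i (t : Sym X) => t (c i) = (val s : Sym X) (c i))
    (nbhs (val s : Sym X))) => i.
  exact: nbhs_sym.
have /set_mem cls := valP s.
by move=> /cls[_ [[g _ <-] [B'g gc]]]; exists g; [exact: sB | exact: gc].
Qed.

Lemma base_stab_hom l : l \in Lam -> base_stab (a l).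
Proof.
move=> lL; rewrite /base_stab /= lmul_coset_base; apply/pi_cosetP.
by rewrite mulg1 gpredV.
Qed.

Lemma base_stab_closure : base_stab `<=` closure (a @` [set` Lam]).
Proof.
move=> s sb B /schlichting_approx -/(_ 1%N (fun=> base))[g Bg gb].
exists (a g); split=> //; exists g => //=.
have := gb ord0; rewrite sb lmul_coset_base => /esym/pi_cosetP.
by rewrite invg1 mul1g.
Qed.

(** An element of Gam that agrees with s on the base point belongs to Lam. *)
Lemma base_stab_orbit s g : base_stab s ->
  exists2 l, l \in Lam & (val s : Sym X) (\pi_X g) = \pi_X (l * g)%g.
Proof.
move=> sb; have [l _ lc] := @schlichting_approx s 2
  (fun i => if i == ord0 then base else \pi_X g) setT filterT.
exists l; last by rewrite -(lc ord_max) /= lmul_coset_pi.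
have /= := lc ord0; rewrite sb lmul_coset_base => /esym/pi_cosetP.
by rewrite invg1 mul1g.
Qed.

(** The coset of l in Lam modulo the conjugate of Lam by g determines the coset
    of l g modulo Lam. *)
Lemma finite_orbit : commensurated Lam -> forall g,
  finite_set [set \pi_X (l * g)%g | l in [set` Lam]].
Proof.
move=> comL g; have [fin _] := comL g.
apply: sub_finite_set (finite_image (fun A => \pi_X (xget 1%g A * g)%g) fin).
move=> _ [l lL <-]; eexists; first by exists l.
set A := image _ _; have : A (xget 1%g A).
  apply: (@xgetPex _ 1%g A); exists l; exists 1%g; last by rewrite mulg1.
  split; first by rewrite /= gpred1.
  by exists 1%g; [rewrite /= gpred1 | rewrite mulg1 mulgV].
move=> [_ [_ [h hL <-]] <-]; apply/pi_cosetP.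
rewrite -[(l * _ * g)%g]mulgA mulgVK mulgA invgM mulgVK.
by rewrite invgM mulgVK gpredV.
Qed.

(** Since U is a group with finite orbits, along an ultrafilter on U both s x and
    s^-1 x are eventually constant for every x; the two limit maps are inverse
    to each other.  The inverses are needed for the limit to be bijective. *)
Lemma base_stab_compact : commensurated Lam -> compact base_stab.
Proof.
move=> comL; rewrite compact_ultra => F UF FU.
have PF : ProperFilter F := ultra_proper.
have stabV s : base_stab s -> base_stab s^-1%g.
  move=> sb; rewrite /base_stab /=.
  rewrite -[LHS]/(sym_invfun (val s : Sym X) base) -[in LHS]sb; exact: sym_invfunK.
have const (phi : G -> G) : (forall s, base_stab s -> base_stab (phi s)) ->
    exists e : X -> X, forall c, \forall s \near F, (val (phi s) : Sym X) c = e c.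
  move=> phiU.
  suff /choice[e eE] : forall c, exists d,
      \forall s \near F, (val (phi s) : Sym X) c = d.
    by exists e.
  move=> c.
  have /finite_seqP[r Er] := finite_orbit comL (repr c).
  apply: (ultra_finite_const (r := r)) => //; apply: filterS FU => s /phiU sb.
  have [l lL] := base_stab_orbit (repr c) sb; rewrite reprK => ->.
  by have : [set` r] (\pi_X (l * repr c)%g) by rewrite -Er; exists l.
have [e eE] := const id (fun _ H => H).
have [e' e'E] := const (fun s => s^-1%g) stabV.
have ee' : cancel e e'.
  move=> c; have [s [sc sc']] := filter_ex (filterI (eE c) (e'E (e c))).
  by rewrite -sc' -sc; exact: sym_invfunK.
have e'e : cancel e' e.
  move=> c; have [s [sc sc']] := filter_ex (filterI (e'E c) (eE (e' c))).
  by rewrite -sc' -sc; exact: sym_invfunVK.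
pose sigma : Sym X := MkSym (asboolT (Bijective ee' e'e)).
have csig : (val : G -> Sym X) @ F --> sigma by apply: cvg_sym => c; exact: eE.
have clsig : sigma \in closure (range (@coset_action Gam Lam)).
  apply/mem_set; apply: (closed_cvg _ (@closed_closure _ _) _ _ csig).
  by apply: nearW => s; apply/set_mem; exact: (valP s).
exists (exist _ sigma clsig : G); split; last exact: cvg_image_closure.
rewrite /base_stab /=; have [s [<-]] := filter_ex (filterI (eE base) FU).
by [].
Qed.
End SchlichtingTopology.

(** * Restriction and induction of cochains *)

Lemma cohomology_map_bijective (K : pzRingType) (C D : cochainComplex K)
    (f : cochainMap C D) (g : cochainMap D C) n :
  (forall z : cocycle C n, cocycle_map g (cocycle_map f z) - z \in @coboundary K C n) ->
  (forall z : cocycle D n, cocycle_map f (cocycle_map g z) - z \in @coboundary K D n) ->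
  bijective (@cohomology_map K C D f n).
Proof.
move=> gf fg; exists (@cohomology_map K D C g n) => c; rewrite -[c]reprK.
  by rewrite (cohomology_map_pi f) cohomology_map_pi; apply/pi_quotmodP; exact: gf.
by rewrite (cohomology_map_pi g) cohomology_map_pi; apply/pi_quotmodP; exact: fg.
Qed.

Section PrismCochain.
Variables (R : realType) (Gam : groupType) (Lam : groupClosed Gam) (M : mean R Lam).
Variables (G : topologicalGroupType) (a : Gam -> G).
Hypothesis prism_cont : forall n (f : tuples G n.+1 -> R), continuous f ->
  continuous (prism M a f : tuples G n -> R).

Lemma prism_cochain_subproof n (f : cochain R G n.+1) :
  (prism M a f : tuples G n.+1 -> R) \in @cochain_pred R G n.
Proof.
have [cf If] := cochainP f; apply/asboolP; split; first exact: prism_cont.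
move=> g x; rewrite -[diag_mul g x]/(ltrans g x) prism_ltrans; congr (prism _ _ _ _).
by apply/funext => y; exact: If.
Qed.

(** In degree 0 the prism of the cocycle is zero, in accordance with the
    convention that only the zero cocycle is a coboundary there. *)
Lemma smear_cohomologous n (z w : cocycle (cont_cochains R G) n) :
  (forall x, cochain_fun (val w) x = smear M a (val z) x) ->
  w - z \in @coboundary R (cont_cochains R G) n.
Proof.
move=> wz.
have dz : altsum (val z) = fun=> 0.
  have /eqP/(congr1 (@cochain_fun R G n.+1)) : diff (cont_cochains R G) n (val z) == 0.
    by case: (z).
  by move=> dz0; apply/funext => x; exact: (congr1 (@^~ x) dz0).
have H x : altsum (prism M a (val z)) x = cochain_fun (val w) x - cochain_fun (val z) x.
  by rewrite wz -prism_homotopy dz prism_cst0 addr0.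
case: n => [|n] in z w wz dz H *; rewrite unfold_in /=.
  rewrite subr_eq0; apply/eqP/val_inj/val_inj/funext => x; apply/eqP.
  by rewrite -subr_eq0 -[_ - _]H altsum0.
apply/asboolP; exists (Cochain (prism_cochain_subproof (val z))).
by apply/val_inj/funext => x; rewrite /= -[LHS]H.
Qed.
End PrismCochain.

Lemma discrete_tuples_continuous (Gam : groupType) (T : topologicalType) n
  (f : tuples (discrete_topology Gam) n -> T) : continuous f.
Proof.
move=> x A /nbhs_singleton Ax; have FF : Filter (nbhs x) by exact: nbhs_filter.
have : \forall z \near x, forall i, [set x i] (z i).
  apply: (@near_tuples _ _ x (fun i => [set x i])) => i.
  exact: (@discrete_set1 (discrete_topology Gam)).
by apply: filterS => z zx; have -> : z = x by apply/funext.
Qed.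

Section Inverse.
Variables (R : realType) (Gam : groupType) (Lam : groupClosed Gam) (M : mean R Lam).
Local Open Scope quotient_scope.
Local Notation G := (schlichting Lam).
Local Notation X := (coset_space Lam).
Local Notation a := (schlichting_hom Lam).
Local Notation D := (discrete_topology Gam).

(** A choice of g in Gam whose image has the same coset modulo the stabiliser
    of the base point as s. *)
Definition coset_rep (s : G) : D := repr ((val s : Sym X) (base Lam)).

(** The identity of Gam, as a map into the group with its discrete topology:
    the homomorphism along which cochains of Gam are smeared. *)
Definition to_discrete (g : Gam) : D := g.

Lemma smear_coset n (f : tuples D n -> R) (x y : tuples D n) :
  (forall i, \pi_X (x i) = \pi_X (y i)) ->
  smear M to_discrete f y = smear M to_discrete f x.
Proof.
move=> xy; apply: smear_rtrans => // i; exists ((x i)^-1 * y i)%g.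
  by apply/pi_cosetP.
by rewrite mulVKg.
Qed.

Definition induced n (f : cochain R D n) : tuples G n.+1 -> R :=
  fun x => smear M to_discrete f (coset_rep \o x).

(** The value depends only on the cosets of the arguments.  These are locally
    constant, whence continuity, and on given cosets an element of the completion
    acts like some m in Gam, whence invariance. *)
Lemma induced_subproof n (f : cochain R D n) : induced f \in @cochain_pred R G n.
Proof.
have [_ If] := cochainP f; apply/asboolP; split=> [x|g x].
  move=> A /nbhs_singleton Ax; have FF : Filter (nbhs x) by exact: nbhs_filter.
  have : \forall z \near x, forall i,
      (val (z i) : Sym X) (base Lam) = (val (x i) : Sym X) (base Lam).
    apply: (@near_tuples _ _ x
      (fun i => [set s | (val s : Sym X) (base Lam) = _])) => i.
    exact: schlichting_near.
  apply: filterS => z zx; rewrite /= /induced.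
  suff -> : coset_rep \o z = coset_rep \o x by [].
  by apply/funext => i; rewrite /= /coset_rep zx.
have [m _ mx] := schlichting_approx
  (fun i => (val (x i) : Sym X) (base Lam)) (@filterT _ (nbhs g) _).
rewrite /induced (@smear_coset _ _ (ltrans (m : D) (coset_rep \o x))).
  by rewrite smear_ltrans; congr (smear _ _ _ _); apply/funext => y; exact: If.
move=> i; rewrite /= /coset_rep reprK; apply: etrans (mx i).
by rewrite -[in RHS](reprK ((val (x i) : Sym X) (base Lam))) lmul_coset_pi.
Qed.

Definition induced_cochain n (f : cochain R D n) : cochain R G n :=
  Cochain (induced_subproof f).

Lemma induced_linear n : linear (@induced_cochain n).
Proof.
by move=> c f h; apply: val_inj; apply/funext => x; exact: smearP.
Qed.

HB.instance Definition _ n := GRing.isLinear.Build R (cochain R D n)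
  (cochain R G n) _ (@induced_cochain n) (@induced_linear n).

Lemma induced_diff n (f : cochain R D n) :
  induced_cochain (cochain_diff f) = cochain_diff (induced_cochain f).
Proof.
by apply: val_inj; apply/funext => x; exact: (smear_altsum M to_discrete).
Qed.

Definition induced_map : cochainMap (cont_cochains R D) (cont_cochains R G) :=
  @CochainMap R (cont_cochains R D) (cont_cochains R G)
    (fun n => @induced_cochain n : {linear cochain R D n -> cochain R G n})
    induced_diff.

Lemma pullback_induced n (f : cochain R D n) x :
  pullback a (induced_cochain f) x = smear M to_discrete f x.
Proof.
apply: smear_coset => i; rewrite /= /map_tuple /coset_rep reprK.
by rewrite /= lmul_coset_base.
Qed.

(** Both sides are the smeared f, on the left at representatives that differ
    from the arguments by elements of the compact stabiliser. *)
Lemma induced_pullback (comL : commensurated Lam) n (f : cochain R G n) x :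
  induced_cochain (pullback a f) x = smear M a f x.
Proof.
have [cf _] := cochainP f.
rewrite /= /induced -(smear_comp M to_discrete (b := a));
  last by move=> g h; exact: gmulfM.
apply: (smear_rtrans_compact M (base_stab_compact comL) (@base_stab_hom _ Lam) _
   (@base_stab_closure _ Lam) cf).
  by move=> g h; exact: gmulfM.
move=> i; rewrite /base_stab /= lmul_coset_base /coset_rep reprK; exact: sym_invfunK.
Qed.

End Inverse.

Theorem theorem1p3 (R : realType) (Gam : groupType) (Lam : groupClosed Gam)
    (lfL : locally_finite Lam) (comL : commensurated Lam) (n : nat) :
  bijective (restriction R (schlichting_hom Lam) n
    : cont_cohomology R (schlichting Lam) n -> group_cohomology R Gam n).
Proof.
have [M] := mean_exists R lfL.
apply: (cohomology_map_bijective (g := induced_map M)) => z.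
  apply: (smear_cohomologous (M := M) (a := schlichting_hom Lam)).
    move=> m f cf.
    exact: (prism_continuous (base_stab_compact comL) (@base_stab_hom _ Lam) cf).
  by move=> x; exact: induced_pullback.
apply: (smear_cohomologous (M := M) (a := @to_discrete Gam)).
  by move=> m f _; exact: discrete_tuples_continuous.
by move=> x; exact: pullback_induced.
Qed.
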